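(* Let $I$ be a set, $J$ a non-empty set, and $\rho\subseteq I\times J$, forming the incidence structure $R=(I,\rho,J)$. For $i\in I$ let $R(i):=\{j\in J:(i,j)\in\rho\}$ and for $j\in J$ let $R^{-1}(j):=\{i\in I:(i,j)\in\rho\}$. Let $\mathcal B(R)$ be the Boolean subalgebra of $\mathfrak P(J)$ generated by $\{R(i):i\in I\}$ and $\mathcal L(R)$ the bounded sublattice of $(\mathfrak P(J),\cup,\cap,\emptyset,J)$ generated by $\{R(i):i\in I\}$. Let $\mathcal C_R:=\{R^{-1}(j):j\in J\}\subseteq\mathfrak P(I)$ and let $\overline{\mathcal C}_R$ be its closure in $\mathfrak P(I)\cong 2^I$ with the product topology. Then $\overline{\mathcal C}_R$, with the topology induced from $\mathfrak P(I)$, is homeomorphic to the Stone space of $\mathcal B(R)$; and $\overline{\mathcal C}_R$, with this topology together with the order of inclusion, is isomorphic (as an ordered topological space) to the Priestley space of $\mathcal L(R)$.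
   Context: $\mathfrak P(I)$ is identified with $2^I$ and carries the product topology, a basis of which consists of the sets $O(F,G)=\{X\subseteq I: F\subseteq X,\ G\cap X=\emptyset\}$ with $F,G$ finite subsets of $I$. The Stone space of a Boolean algebra is its set of ultrafilters (prime filters) with the usual Stone topology; the Priestley space of a bounded distributive lattice is its set of prime filters with the Priestley topology and ordered by inclusion. *)

(* Defs.v *)
From HB Require Import structures.
From mathcomp Require Import all_boot all_order.
From mathcomp Require Import all_classical topology.

Set Implicit Arguments.
Unset Strict Implicit.
Unset Printing Implicit Defensive.
Import Order.TTheory.
Local Open Scope classical_set_scope.

Section Homeomorphism.

Definition homeomorphism (X Y : topologicalType) (f : X -> Y) : Prop :=
  continuous f /\ exists g : Y -> X, [/\ continuous g, cancel f g & cancel g f].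

Definition homeomorphic (X Y : topologicalType) : Prop :=
  exists f : X -> Y, homeomorphism f.

Definition ordered_homeomorphic (X Y : topologicalType)
    (leX : X -> X -> Prop) (leY : Y -> Y -> Prop) : Prop :=
  exists2 f : X -> Y, homeomorphism f & forall x y, leX x y <-> leY (f x) (f y).

End Homeomorphism.
Arguments ordered_homeomorphic : clear implicits.

Section PowersetSpace.
Variable I : Type.

Definition indicator (X : set I) : {ptws I -> bool} := fun i => `[< X i >].

(* As [indicator] is a bijection from [set I] onto 2^I, the initial topology
   along it is the product topology transported to [set I]. *)
Definition powerset_space : Type := set I.

HB.instance Definition _ :=
  Topological.copy powerset_space (initial_topology indicator).

End PowersetSpace.

Section Filters.
Context {d : Order.disp_t} {L : tbDistrLatticeType d}.
Implicit Types F : set L.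

Definition proper_filter F : Prop :=
  [/\ F \top%O, ~ F \bot%O,
      forall a b, F a -> F b -> F (a `&` b)%O &
      forall a b, (a <= b)%O -> F a -> F b].

Definition prime_filter F : Prop :=
  proper_filter F /\ forall a b, F (a `|` b)%O -> F a \/ F b.

Definition ultrafilter F : Prop :=
  proper_filter F /\ forall G : set L, proper_filter G -> F `<=` G -> G = F.

End Filters.

Section StoneSpace.
Context {d : Order.disp_t} (B : ctbDistrLatticeType d).

Definition stone_space : Type := [set F : set B | ultrafilter F].

HB.instance Definition _ := Choice.on stone_space.

(* As ultrafilters are closed under finite meets, these sets form a base, and
   not merely a subbase, of the Stone topology. *)
Definition stone_open (a : B) : set stone_space := [set F | (\val F : set B) a].

HB.instance Definition _ :=
  isSubBaseTopological.Build stone_space (range stone_open) id.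

End StoneSpace.

Section PriestleySpace.
Context {d : Order.disp_t} (L : tbDistrLatticeType d).

Definition priestley_space : Type := [set F : set L | prime_filter F].

HB.instance Definition _ := Choice.on priestley_space.

Definition priestley_open (a : L) : set priestley_space :=
  [set F | (\val F : set L) a].

HB.instance Definition _ := isSubBaseTopological.Build priestley_space
  (range priestley_open `|` range (fun a => ~` priestley_open a)) id.

Definition priestley_le (F G : priestley_space) : Prop :=
  (\val F : set L) `<=` \val G.

End PriestleySpace.
Arguments priestley_le {d} L F G.

Section GeneratedAlgebras.
Context {J : Type}.
Implicit Types S G : set (set J).

Definition is_bounded_sublattice S : Prop :=
  [/\ S set0, S setT, setU_closed S & setI_closed S].

Definition is_boolean_subalgebra S : Prop :=
  is_bounded_sublattice S /\ forall A, S A -> S (~` A).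

(* [smallest P G] is the intersection of all [S] satisfying [P] that contain
   [G]; below, its elements form a sublattice (subalgebra) of the library's
   Boolean algebra [set J], ordered by inclusion. *)
Definition gen_lattice G : Type := smallest is_bounded_sublattice G.

Definition gen_boolean G : Type := smallest is_boolean_subalgebra G.

Lemma smallest_sublattice G :
  is_bounded_sublattice (smallest is_bounded_sublattice G).
Proof.
split.
- by move=> M [[]].
- by move=> M [[]].
- by move=> A B SA SB M HM; case: (HM) => -[_ _ + _] _; apply; [exact: SA|exact: SB].
- by move=> A B SA SB M HM; case: (HM) => -[_ _ _ +] _; apply; [exact: SA|exact: SB].
Qed.

Lemma smallest_boolean_subalgebra G :
  is_boolean_subalgebra (smallest is_boolean_subalgebra G).
Proof.
split; last by move=> A SA M HM; case: (HM) => -[_ +] _; apply; exact: SA.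
split.
- by move=> M [[[]]].
- by move=> M [[[]]].
- move=> A B SA SB M HM; case: (HM) => -[[_ _ + _] _] _.
  by apply; [exact: SA|exact: SB].
- move=> A B SA SB M HM; case: (HM) => -[[_ _ _ +] _] _.
  by apply; [exact: SA|exact: SB].
Qed.

Section Closed.
Variable S : set (set J).
Hypothesis HS : is_bounded_sublattice S.

Lemma sublattice_meet : Order.ClosedPredicates.meet_closed [pred A | A \in S].
Proof.
case: HS => _ _ _ SI A B SA SB; apply/mem_set.
by apply: SI; apply: set_mem.
Qed.

Lemma sublattice_join : Order.ClosedPredicates.join_closed [pred A | A \in S].
Proof.
case: HS => _ _ SU _ A B SA SB; apply/mem_set.
by apply: SU; apply: set_mem.
Qed.

Lemma sublattice_bot : (\bot : set J)%O \in [pred A | A \in S].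
Proof. by case: HS => S0 _ _ _; apply/mem_set. Qed.

Lemma sublattice_top : (\top : set J)%O \in [pred A | A \in S].
Proof. by case: HS => _ ST _ _; apply/mem_set. Qed.

End Closed.

Section Instances.
Variable G : set (set J).

HB.instance Definition _ := SubChoice.on (gen_lattice G).
HB.instance Definition _ :=
  Order.SubChoice_isTBSubLattice.Build _ _ _ set_display (gen_lattice G)
    (sublattice_meet (smallest_sublattice G))
    (sublattice_join (smallest_sublattice G))
    (sublattice_bot (smallest_sublattice G))
    (sublattice_top (smallest_sublattice G)).

Lemma gen_lattice_meetUl :
  @left_distributive (gen_lattice G) _ Order.meet Order.join.
Proof. by move=> A B C; apply: val_inj; exact: setIUl. Qed.

HB.instance Definition _ := Order.Lattice_Meet_isDistrLattice.Build
  set_display (gen_lattice G) gen_lattice_meetUl.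

HB.instance Definition _ := SubChoice.on (gen_boolean G).
HB.instance Definition _ :=
  Order.SubChoice_isTBSubLattice.Build _ _ _ set_display (gen_boolean G)
    (sublattice_meet (smallest_boolean_subalgebra G).1)
    (sublattice_join (smallest_boolean_subalgebra G).1)
    (sublattice_bot (smallest_boolean_subalgebra G).1)
    (sublattice_top (smallest_boolean_subalgebra G).1).

Lemma gen_boolean_meetUl :
  @left_distributive (gen_boolean G) _ Order.meet Order.join.
Proof. by move=> A B C; apply: val_inj; exact: setIUl. Qed.

HB.instance Definition _ := Order.Lattice_Meet_isDistrLattice.Build
  set_display (gen_boolean G) gen_boolean_meetUl.

Definition gen_boolean_compl (A : gen_boolean G) : gen_boolean G :=
  SigSub (mem_set ((smallest_boolean_subalgebra G).2 _ (set_mem (valP A)))).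

Lemma gen_boolean_joinC A : (A `|` gen_boolean_compl A)%O = \top%O.
Proof. by apply: val_inj; exact: setUv. Qed.

Lemma gen_boolean_meetC A : (A `&` gen_boolean_compl A)%O = \bot%O.
Proof. by apply: val_inj; exact: setICr. Qed.

HB.instance Definition _ := Order.TBDistrLattice_hasComplement.Build
  set_display (gen_boolean G) gen_boolean_joinC gen_boolean_meetC.

End Instances.
End GeneratedAlgebras.

Section Incidence.
Context {I J : Type}.
Variable rho : set (I * J).

Definition incidence_row (i : I) : set J := [set j | rho (i, j)].

Definition incidence_col (j : J) : set I := [set i | rho (i, j)].

Definition incidence_boolean : ctbDistrLatticeType set_display :=
  gen_boolean (range incidence_row).

Definition incidence_lattice : tbDistrLatticeType set_display :=
  gen_lattice (range incidence_row).

Definition incidence_cols : set (powerset_space I) := range incidence_col.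

Definition incidence_closure : topologicalType := closure incidence_cols.

Definition incidence_le (X Y : incidence_closure) : Prop :=
  (\val X : set I) `<=` \val Y.

End Incidence.
Arguments incidence_le {I J} rho X Y.

(* Main.v *)
(* A point [X] of the closure goes to the set of those [A] in the algebra such
   that, for [Y] close to [X], every [j] with column [Y] lies in [A]; a prime
   filter [F] comes back as [{i | R(i) \in F}]. Near [X] the membership of [i]
   is constant, so every row, and hence every element of the generated algebra,
   is decided near [X] by itself or by its complement. This gives primality and
   makes the conditions [A \in F] clopen, so both maps are continuous without
   any appeal to compactness. *)
Require Import Defs.
From mathcomp Require Import all_boot all_order finmap.
From mathcomp Require Import all_classical topology.

Local Open Scope classical_set_scope.

Set Implicit Arguments.
Unset Strict Implicit.
Unset Printing Implicit Defensive.
Import Order.Theory.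

(** * Topologies given by a subbase *)

Section Subbase.
Context {T : topologicalType} {S : set (set T)}.
(** The topology with subbase [S], unfolded; for both dual spaces this equation holds by
    conversion. *)
Hypothesis openS :
  @open T = [set \bigcup_(A in D) A | D in subset^~ (finI_from S id)].

Lemma subbase_open A : S A -> open A.
Proof.
move=> SA; rewrite openS; exists [set A]; last by rewrite bigcup_set1.
move=> _ ->; exists [fset A]%fset; first by
  move=> B; rewrite in_fset1 => /eqP->; exact/mem_set.
by rewrite set_fset1 bigcap_set1.
Qed.

Lemma subbase_continuous (X : topologicalType) (f : X -> T) :
  (forall A, S A -> open (f @^-1` A)) -> continuous f.
Proof.
move=> fS; apply/continuousP => A; rewrite openS => -[D DS <-].
rewrite preimage_bigcup; apply: bigcup_open => B /DS[G GS <-].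
rewrite preimage_bigcap openE => x Gx.
by apply: filter_bigI => C GC; apply: open_nbhs_nbhs; split;
  [apply/fS/set_mem/GS|apply: Gx].
Qed.

End Subbase.

(** * Convergence in the powerset space *)

Section Powerset.
Context {I : Type}.

Lemma powerset_cvgP (F : set_system (powerset_space I)) (X : powerset_space I) :
  Filter F ->
  F --> X <-> forall i, F [set Y : powerset_space I | Y i <-> X i].
Proof.
move=> FF; split=> [FX i|FX].
  have cI : {for X, continuous ((@^~ i : {ptws I -> bool} -> bool) \o
      (@indicator I : powerset_space I -> {ptws I -> bool}))}.
    apply: continuous_comp; first exact: initial_continuous.
    exact: (@proj_continuous {classic I} (fun=> bool)).
  apply: FX; have : nbhs (indicator X i) [set b : bool | b = indicator X i].
    by apply: open_nbhs_nbhs; split=> //; exact: discrete_open.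
  move=> /cI XI; apply: (@filterS _ (nbhs X) _ _ _ _ XI) => Y.
  exact: asbool_eq_equiv.
have iX : @indicator I @ F --> (indicator X : {ptws I -> bool}).
  (* The product topology is the supremum of the initial topologies along the projections, so one
     coordinate at a time suffices. *)
  apply/cvg_sup => i N [_ [[U oU <-] /= UX UN]].
  apply: (@filterS _ F _ _ _ _ (FX i)) => Y YX; apply: UN => /=.
  by rewrite /indicator (asbool_equiv_eq YX).
move=> N [_ [[U oU <-] /= UX UN]].
by apply: filterS UN _; apply: iX; apply: open_nbhs_nbhs.
Qed.

Lemma near_coord (X : powerset_space I) i : \forall Y \near X, Y i <-> X i.
Proof. by move: i; apply/(powerset_cvgP X (nbhs_filter X)) => A. Qed.

End Powerset.

(** * Prime filters and ultrafilters *)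

Section PrimeFilters.
Context {d : Order.disp_t}.

(** Phrased for a complementary pair, so that it also applies in a lattice without a complement
    operation. *)
Lemma prime_filter_compl (L : tbDistrLatticeType d) (F : set L) a b :
  prime_filter F -> (a `&` b = \bot)%O -> (a `|` b = \top)%O -> F a <-> ~ F b.
Proof.
move=> [[F1 F0 FI FS] FP] ab0 ab1; split=> [Fa Fb|nFb].
  by apply: F0; rewrite -ab0; exact: FI.
by have [||//] := FP a b; rewrite ?ab1.
Qed.

Lemma ultrafilterP (B : ctbDistrLatticeType d) (F : set B) :
  ultrafilter F <-> prime_filter F.
Proof.
split=> [[PF Fmax]|PF]; last first.
  split=> [|G [_ G0 GI _] FG]; first exact: PF.1.
  rewrite eqEsubset; split=> // a Ga; apply: contrapT => nFa; apply: G0.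
  rewrite -(meetxC a); apply: GI => //; apply: FG.
  by apply/(prime_filter_compl PF (meetCx a) (joinCx a)).
split=> // a b Fab; apply: contrapT => /not_orP[nFa nFb].
have [F1 F0 FI FS] := PF.
(* [G] is the filter generated by [F] and [a]. If it is proper, maximality puts [a] in [F];
   otherwise [a] is disjoint from some [f] in [F], and then [(a | b) & f] lies below [b]. *)
pose G := [set c | exists2 f, F f & (a `&` f <= c)%O].
have FG : F `<=` G by move=> f Ff; exists f => //; rewrite leIr.
have Ga : G a by exists \top%O => //; rewrite leIl.
have [[f Ff]|nG0] := pselect (G \bot%O).
  rewrite lex0 => /eqP af0; apply: nFb; apply: (FS ((a `|` b) `&` f)%O).
    by rewrite meetUl af0 join0x leIl.
  exact: FI.
suff PG : proper_filter G by apply: nFa; rewrite -(Fmax G).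
split=> //.
- exact: FG.
- move=> c e [f Ff afc] [g Fg age]; exists (f `&` g)%O; first exact: FI.
  by rewrite lexI (le_trans _ afc) ?(le_trans _ age)// leI2// ?leIl ?leIr.
- by move=> c e ce [f Ff afc]; exists f => //; exact: le_trans ce.
Qed.

End PrimeFilters.

(** * Clopen sets of the Stone and Priestley spaces *)

Section DualSpaces.
Context {d : Order.disp_t}.

Lemma stone_subbase (B : ctbDistrLatticeType d) : @open (stone_space B) =
  [set \bigcup_(A in D) A |
    D in subset^~ (finI_from (range (@stone_open d B)) id)].
Proof. by []. Qed.

Lemma priestley_subbase (L : tbDistrLatticeType d) : @open (priestley_space L) =
  [set \bigcup_(A in D) A | D in subset^~ (finI_from
    (range (@priestley_open d L) `|` range (fun a => ~` priestley_open a)) id)].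
Proof. by []. Qed.

Lemma range_stone (B : ctbDistrLatticeType d) :
  range (\val : stone_space B -> set B) = prime_filter.
Proof.
rewrite predeqE => F; rewrite -ultrafilterP; split=> [[G _ <-]|UF].
  exact: set_mem (valP G).
by exists (SigSub (mem_set UF)).
Qed.

Lemma range_priestley (L : tbDistrLatticeType d) :
  range (\val : priestley_space L -> set L) = prime_filter.
Proof.
rewrite predeqE => F; split=> [[G _ <-]|PF]; first exact: set_mem (valP G).
by exists (SigSub (mem_set PF)).
Qed.

(** Hence the subbasic sets are clopen, as they are by definition in the Priestley space, and one
    argument can serve both spaces. *)
Lemma stone_openC (B : ctbDistrLatticeType d) (a : B) :
  ~` stone_open a = stone_open (~` a)%O.
Proof.
rewrite predeqE => F; have /ultrafilterP PF := set_mem (valP F).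
apply: iff_sym; apply: (prime_filter_compl PF); first exact: meetCx.
exact: joinCx.
Qed.

Lemma open_stone (B : ctbDistrLatticeType d) (a : B) :
  open (stone_open a) /\ open (~` stone_open a).
Proof.
rewrite stone_openC.
by split; apply: (subbase_open (stone_subbase B)); exact: imageT.
Qed.

Lemma continuous_stone (B : ctbDistrLatticeType d) (X : topologicalType)
    (f : X -> stone_space B) :
  (forall a, open (f @^-1` stone_open a)) -> continuous f.
Proof.
move=> fo; apply: (subbase_continuous (stone_subbase B)) => _ [a _ <-].
exact: fo.
Qed.

Lemma open_priestley (L : tbDistrLatticeType d) (a : L) :
  open (priestley_open a) /\ open (~` priestley_open a).
Proof.
by split; apply: (subbase_open (priestley_subbase L)); [left|right]; exists a.
Qed.

Lemma continuous_priestley (L : tbDistrLatticeType d) (X : topologicalType)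
    (f : X -> priestley_space L) :
  (forall a, open (f @^-1` priestley_open a) /\
             open (f @^-1` (~` priestley_open a))) ->
  continuous f.
Proof.
move=> fo; apply: (subbase_continuous (priestley_subbase L)) => _ [] [a _ <-].
  exact: (fo a).1.
exact: (fo a).2.
Qed.

End DualSpaces.

(** * Points of the closure versus prime filters *)

Section Representation.
Context {I J : Type} (rho : set (I * J)).

(* What the generated Boolean algebra and the generated lattice have in common;
   complements enter only through elements already known to be complementary,
   so that both satisfy the induction principle. *)
Record incidence_representation {d : Order.disp_t} {L : tbDistrLatticeType d}
    (v : L -> set J) (r : I -> L) : Prop := IncidenceRepresentation {
  rep_bot : v \bot%O = set0;
  rep_top : v \top%O = setT;
  rep_join : forall a b, v (a `|` b)%O = v a `|` v b;
  rep_meet : forall a b, v (a `&` b)%O = v a `&` v b;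
  rep_le : forall a b, (a <= b)%O = (v a `<=` v b) :> Prop;
  rep_row : forall i, v (r i) = incidence_row rho i;
  rep_ind : forall Q : set L, Q \bot%O -> Q \top%O ->
    (forall a b, Q a -> Q b -> Q (a `|` b)%O) ->
    (forall a b, Q a -> Q b -> Q (a `&` b)%O) ->
    (forall a b, (a `&` b = \bot)%O -> (a `|` b = \top)%O -> Q a -> Q b) ->
    (forall i, Q (r i)) -> forall a, Q a }.

(* [col_trace A] consists of the points [X] such that [A] belongs to the filter
   on [J] inverse image of the neighbourhoods of [X] along [incidence_col]. *)
Definition col_trace (A : set J) : set (powerset_space I) :=
  interior [set Y : powerset_space I |
    forall j, incidence_col rho j = Y -> A j].

Lemma open_col_trace A : open (col_trace A).
Proof. exact: open_interior. Qed.

Lemma col_traceT : col_trace setT = setT.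
Proof. by rewrite -subTset => X _; exact: (@filterE _ (nbhs X)). Qed.

Lemma col_traceS A B : A `<=` B -> col_trace A `<=` col_trace B.
Proof. by move=> AB; apply: interiorS => Y YA j /YA/AB. Qed.

Lemma col_traceI A B : col_trace (A `&` B) = col_trace A `&` col_trace B.
Proof.
rewrite /col_trace -interiorI; congr interior; rewrite predeqE => Y; split.
  by move=> YAB; split=> j /YAB[].
by move=> [YA YB] j jY; split; [apply: YA|apply: YB].
Qed.

(** A point outside the closure has a neighbourhood free of columns, hence lies in [col_trace set0];
    membership in the closure is thus what makes the filter proper. *)
Lemma col_trace0 X : closure (incidence_cols rho) X -> ~ col_trace set0 X.
Proof. by move=> clX /clX[_ [[j _ <-] /(_ j erefl)]]. Qed.

Lemma col_trace_row (X : powerset_space I) i :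
  X i -> col_trace (incidence_row rho i) X.
Proof.
move=> Xi; apply: filterS (near_coord X i) => Y YX j jY.
by have := YX.2 Xi; rewrite -jY.
Qed.

Lemma col_trace_rowC (X : powerset_space I) i :
  ~ X i -> col_trace (~` incidence_row rho i) X.
Proof.
move=> Xi; apply: filterS (near_coord X i) => Y YX j jY rji.
by apply: Xi; apply/YX; rewrite -jY.
Qed.

Section Duality.
Context {d : Order.disp_t} {L : tbDistrLatticeType d}.
Context (v : L -> set J) (r : I -> L).
Hypothesis vr : incidence_representation v r.

Lemma col_traceVC X a : col_trace (v a) X \/ col_trace (~` v a) X.
Proof.
move: a; apply: (rep_ind vr) => [|||||i].
- by right; rewrite (rep_bot vr) setC0 col_traceT.
- by left; rewrite (rep_top vr) col_traceT.
- move=> a b; rewrite (rep_join vr) setCU col_traceI.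
  move=> [Ha _|Ha [Hb|Hb]]; [left|left|right=> //].
  + by apply: col_traceS Ha; exact: subsetUl.
  + by apply: col_traceS Hb; exact: subsetUr.
- move=> a b; rewrite (rep_meet vr) setCI col_traceI.
  move=> [Ha [Hb|Hb]|Ha _]; [by left|right..].
  + by apply: col_traceS Hb; exact: subsetUr.
  + by apply: col_traceS Ha; exact: subsetUl.
- move=> a b /(congr1 v) + /(congr1 v).
  rewrite (rep_meet vr) (rep_join vr) (rep_bot vr) (rep_top vr) => ab0 ab1.
  (* Complementary elements have complementary images, so the two alternatives are exchanged. *)
  have -> : v b = ~` v a.
    rewrite predeqE => j; split=> [bj aj|naj].
      by have : set0 j by rewrite -ab0.
    by have [] : (v a `|` v b) j by rewrite ab1.
  by rewrite setCK => -[]; [right|left].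
- rewrite (rep_row vr); have [Xi|Xi] := pselect (X i).
    by left; exact: col_trace_row.
  by right; exact: col_trace_rowC.
Qed.

Lemma col_traceC X a : closure (incidence_cols rho) X ->
  col_trace (~` v a) X <-> ~ col_trace (v a) X.
Proof.
move=> clX; split=> [Ha Ha'|]; last by have [] := col_traceVC X a.
by apply: (col_trace0 clX); rewrite -(setICr (v a)) col_traceI.
Qed.

(** Traces of arbitrary sets need not respect unions; here, if [v a] has no trace at [X], its
    complement has one, and removing [v a] from the union leaves a subset of [v b]. *)
Lemma col_traceU X a b : col_trace (v a `|` v b) X ->
  col_trace (v a) X \/ col_trace (v b) X.
Proof.
move=> Hab; have [|Ha] := col_traceVC X a; first by left.
right; have : (col_trace (v a `|` v b) `&` col_trace (~` v a)) X by [].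
by rewrite -col_traceI; apply: col_traceS => j [[aj /(_ aj)|]].
Qed.

(** This makes [row_set] a left inverse of [col_filter] on the closure. *)
Lemma col_trace_rowE X i : closure (incidence_cols rho) X ->
  col_trace (v (r i)) X <-> X i.
Proof.
move=> clX; split; last by rewrite (rep_row vr); exact: col_trace_row.
move=> HX; apply: contrapT => /col_trace_rowC.
by rewrite -(rep_row vr) => /col_traceC; apply.
Qed.

Definition col_filter (X : powerset_space I) : set L :=
  [set a | col_trace (v a) X].

Lemma col_filter_prime X :
  closure (incidence_cols rho) X -> prime_filter (col_filter X).
Proof.
move=> clX; split; last first.
  by move=> a b; rewrite /col_filter /= (rep_join vr); exact: col_traceU.
split; rewrite /col_filter /=.
- by rewrite (rep_top vr) col_traceT.
- by rewrite (rep_bot vr); exact: col_trace0.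
- by move=> a b aX bX; rewrite (rep_meet vr) col_traceI.
- by move=> a b; rewrite (rep_le vr) => ab; exact: col_traceS.
Qed.

Definition row_set (F : set L) : powerset_space I := [set i | F (r i)].

(* The sets containing [v a `\` v b] for some [a] in [F] and [b] outside [F]
   form a proper filter on [J], whose image under [incidence_col] converges to
   [row_set F]. *)
Lemma closure_row_set F :
  prime_filter F -> closure (incidence_cols rho) (row_set F).
Proof.
move=> PF; have [[F1 F0 FI FS] FP] := PF.
pose H := filter_from [set ab : L * L | F ab.1 /\ ~ F ab.2]
  (fun ab => v ab.1 `\` v ab.2).
have FH : ProperFilter H.
  apply: filter_from_proper; last first.
    move=> [a b] /= [Fa nFb]; apply/set0P/negP => /eqP; rewrite setD_eq0 => ab.
    by apply: nFb; apply: FS Fa; rewrite (rep_le vr).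
  apply: filter_from_filter; first by exists (\top%O, \bot%O).
  move=> [a b] [a' b'] /= [Fa nFb] [Fa' nFb'].
  exists (a `&` a', b `|` b')%O => /=.
    by split; [exact: FI|move=> /FP[]].
  rewrite (rep_meet vr) (rep_join vr) => j [[aj a'j] /not_orP[nbj nb'j]].
  by [].
have HF : incidence_col rho @ H --> row_set F.
  apply/powerset_cvgP => i; rewrite /row_set /=.
  have [Fi|nFi] := pselect (F (r i)).
    exists (r i, \bot%O) => //= j [+ _].
    by rewrite (rep_row vr).
  exists (\top%O, r i) => //= j [_].
  by rewrite (rep_row vr).
move=> N /HF; rewrite /nbhs /= => /(@filter_ex _ H)[j Nj].
by exists (incidence_col rho j); split=> //; exists j.
Qed.

(** Membership in a prime filter commutes with joins, meets and complements, so it is determined on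
    the generators. *)
Lemma prime_filter_ext F G : prime_filter F -> prime_filter G ->
  (forall i, F (r i) <-> G (r i)) -> F = G.
Proof.
move=> PF PG FGr; rewrite predeqE; apply: (rep_ind vr) => //.
- by have [[_ ? _ _] _] := PF; have [[_ ? _ _] _] := PG.
- by have [[? _ _ _] _] := PF; have [[? _ _ _] _] := PG.
- have FU H : prime_filter H -> forall a b, H (a `|` b)%O <-> H a \/ H b.
    move=> [[_ _ _ HS] HP] a b; split=> [/HP//|[]]; apply: HS.
      exact: leUl.
    exact: leUr.
  by move=> a b FGa FGb; rewrite !FU// FGa FGb.
- have FI H : prime_filter H -> forall a b, H (a `&` b)%O <-> H a /\ H b.
    move=> [[_ _ HI HS] _] a b; split=> [Hab|[]]; last exact: HI.
    by split; apply: HS Hab; rewrite ?leIl ?leIr.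
  by move=> a b FGa FGb; rewrite !FI// FGa FGb.
- move=> a b ab0 ab1 FGa.
  rewrite meetC in ab0; rewrite joinC in ab1.
  rewrite (prime_filter_compl PF ab0 ab1) FGa.
  by rewrite (prime_filter_compl PG ab0 ab1).
Qed.

Section Homeomorphism.
(** [T] stands for either dual space and [w] for the filter underlying a point. The topological
    hypotheses say that [T] has the coarsest topology making each condition [w t a] clopen. *)
Context {T : topologicalType} {w : T -> set L}.
Hypotheses (w_inj : injective w) (w_range : range w = prime_filter).
Hypothesis open_w : forall a, open [set t | w t a] /\ open [set t | ~ w t a].
Hypothesis continuous_w : forall (X : topologicalType) (f : X -> T),
  (forall a, open [set x | w (f x) a] /\ open [set x | ~ w (f x) a]) ->
  continuous f.

(** The equation for [w (f X)] is kept in the conclusion to compare the orders later. *)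
Lemma incidence_closure_homeomorphism :
  exists2 f : incidence_closure rho -> T,
    homeomorphism f & forall X, w (f X) = col_filter (\val X).
Proof.
have wP t : prime_filter (w t) by rewrite -w_range; exists t.
have clP (X : incidence_closure rho) : closure (incidence_cols rho) (\val X).
  by have := valP X; rewrite inE.
have /choice[f fE] : forall X : incidence_closure rho,
    exists t, w t = col_filter (\val X).
  move=> X; have := col_filter_prime (clP X).
  by rewrite -w_range => -[t _ <-]; exists t.
pose g (t : T) : incidence_closure rho :=
  SigSub (mem_set (closure_row_set (wP t))).
exists f => //; split; last exists g; last split.
- apply: continuous_w => a.
  have vE : continuous (\val : incidence_closure rho -> powerset_space I).
    exact: initial_continuous.
  split.
    rewrite (_ : mkset _ = \val @^-1` col_trace (v a)).
      by move/continuousP : vE; apply; exact: open_col_trace.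
    by rewrite predeqE => X /=; rewrite fE.
  (* On the closure, failing to contain [a] amounts to the complement of [v a] having a trace, which
     is again an open condition. *)
  rewrite (_ : mkset _ = \val @^-1` col_trace (~` v a)).
    by move/continuousP : vE; apply; exact: open_col_trace.
  rewrite predeqE => X /=; rewrite fE.
  exact: (iff_sym (col_traceC a (clP X))).
(* Coordinate [i] of [row_set (w t)] is the clopen condition [w t (r i)], hence locally constant in
   [t]. *)
- apply: continuous_comp_initial => t; apply/powerset_cvgP => i /=.
  have [oi oNi] := open_w (r i).
  have [wi|wi] := pselect (w t (r i)).
    have := open_nbhs_nbhs (conj oi wi).
    by apply: (@filterS _ (nbhs t)) => s ws; split.
  have := open_nbhs_nbhs (conj oNi wi).
  by apply: (@filterS _ (nbhs t)) => s ws; split.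
- move=> X; apply: val_inj => /=; rewrite predeqE => i.
  rewrite /row_set /= fE; exact: col_trace_rowE.
- move=> t; apply: w_inj; rewrite fE; apply: prime_filter_ext => //.
    exact/col_filter_prime/closure_row_set.
  by move=> i; exact/col_trace_rowE/closure_row_set.
Qed.

End Homeomorphism.
End Duality.
End Representation.

(** * Induction on generated algebras *)

Section Generated.
Context {J : Type} (G : set (set J)).

(** The image of [Q] in [set J] is a bounded sublattice containing [G], hence contains the smallest
    one. *)
Lemma gen_lattice_ind (Q : set (gen_lattice G)) : Q \bot%O -> Q \top%O ->
  (forall a b, Q a -> Q b -> Q (a `|` b)%O) ->
  (forall a b, Q a -> Q b -> Q (a `&` b)%O) ->
  (forall a, G (\val a) -> Q a) -> forall a, Q a.
Proof.
move=> Q0 Q1 QU QI QG a.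
suff : (\val @` Q : set (set J)) (\val a) by move=> [b Qb /val_inj <-].
apply: (set_mem (valP a)); split; first split.
- by exists \bot%O.
- by exists \top%O.
- by move=> _ _ [b Qb <-] [c Qc <-]; exists (b `|` c)%O => //; exact: QU.
- by move=> _ _ [b Qb <-] [c Qc <-]; exists (b `&` c)%O => //; exact: QI.
- move=> A GA; have sA : smallest is_bounded_sublattice G A.
    exact: sub_gen_smallest.
  by exists (SigSub (mem_set sA)) => //; exact: QG.
Qed.

Lemma gen_boolean_ind (Q : set (gen_boolean G)) : Q \bot%O -> Q \top%O ->
  (forall a b, Q a -> Q b -> Q (a `|` b)%O) ->
  (forall a b, Q a -> Q b -> Q (a `&` b)%O) ->
  (forall a, Q a -> Q (~` a)%O) ->
  (forall a, G (\val a) -> Q a) -> forall a, Q a.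
Proof.
move=> Q0 Q1 QU QI QC QG a.
suff : (\val @` Q : set (set J)) (\val a) by move=> [b Qb /val_inj <-].
apply: (set_mem (valP a)); split; first split; first split.
- by exists \bot%O.
- by exists \top%O.
- by move=> _ _ [b Qb <-] [c Qc <-]; exists (b `|` c)%O => //; exact: QU.
- by move=> _ _ [b Qb <-] [c Qc <-]; exists (b `&` c)%O => //; exact: QI.
- by move=> _ [b Qb <-]; exists (~` b)%O => //; exact: QC.
- move=> A GA; have sA : smallest is_boolean_subalgebra G A.
    exact: sub_gen_smallest.
  by exists (SigSub (mem_set sA)) => //; exact: QG.
Qed.

End Generated.

(** * The two generated algebras and the order *)

Section Incidence.
Context {I J : Type} (rho : set (I * J)).

Definition lattice_row (i : I) : incidence_lattice rho :=
  SigSub (mem_set (sub_gen_smallest (imageT (incidence_row rho) i))).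

Definition boolean_row (i : I) : incidence_boolean rho :=
  SigSub (mem_set (sub_gen_smallest (imageT (incidence_row rho) i))).

Lemma lattice_representation :
  incidence_representation rho (\val : incidence_lattice rho -> set J)
    lattice_row.
Proof.
split=> //.
- by move=> a b; rewrite -subsetEset.
- move=> Q Q0 Q1 QU QI _ Qr; apply: gen_lattice_ind => // a [i _ ia].
  by rewrite (_ : a = lattice_row i)//; exact: val_inj.
Qed.

Lemma boolean_representation :
  incidence_representation rho (\val : incidence_boolean rho -> set J)
    boolean_row.
Proof.
split=> //.
- by move=> a b; rewrite -subsetEset.
- move=> Q Q0 Q1 QU QI QC Qr; apply: gen_boolean_ind => //.
    by move=> a; apply: QC; [exact: meetxC|exact: joinxC].
  move=> a [i _ ia].
  by rewrite (_ : a = boolean_row i)//; exact: val_inj.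
Qed.

(** From right to left, test on the rows. From left to right, induct on the lattice element: joins
    and meets preserve the inclusion of prime filters, and no complement has to be treated. *)
Lemma incidence_leE (X Y : incidence_closure rho) :
  incidence_le rho X Y <->
  col_filter rho (\val : incidence_lattice rho -> set J) (\val X) `<=`
  col_filter rho (\val : incidence_lattice rho -> set J) (\val Y).
Proof.
have vr := lattice_representation.
have clP (Z : incidence_closure rho) : closure (incidence_cols rho) (\val Z).
  by have := valP Z; rewrite inE.
split=> [XY|XY i /(col_trace_rowE vr i (clP X))/XY]; last first.
  by move/(col_trace_rowE vr i (clP Y)).
have [[X1 X0 XI XS] XP] := col_filter_prime vr (clP X).
have [[Y1 Y0 YI YS] YP] := col_filter_prime vr (clP Y).
apply: gen_lattice_ind => //.
- by move=> a b ab_a ab_b /XP[/ab_a|/ab_b]; apply: YS; rewrite ?leUl ?leUr.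
- move=> a b ab_a ab_b Xab; apply: YI; [apply: ab_a|apply: ab_b];
    by apply: XS Xab; rewrite ?leIl ?leIr.
- move=> a [i _ ia]; have -> : a = lattice_row i by exact: val_inj.
  by move/(col_trace_rowE vr i (clP X))/XY/(col_trace_rowE vr i (clP Y)).
Qed.

End Incidence.

Theorem theorem2 (I J : Type) (hJ : [set: J] !=set0) (rho : set (I * J)) :
  homeomorphic (incidence_closure rho) (stone_space (incidence_boolean rho)) /\
  ordered_homeomorphic
    (incidence_closure rho) (priestley_space (incidence_lattice rho))
    (incidence_le rho) (priestley_le (incidence_lattice rho)).
Proof.
split.
  have [||f fh _] := incidence_closure_homeomorphism
    (boolean_representation rho) (T := stone_space _) val_inj (range_stone _).
  - by move=> a; exact: open_stone.
  - by move=> X f fo; apply: continuous_stone => a; exact: (fo a).1.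
  - by exists f.
have [||f fh fE] := incidence_closure_homeomorphism
  (lattice_representation rho) (T := priestley_space _) val_inj
  (range_priestley _).
- by move=> a; exact: open_priestley.
- by move=> X f fo; apply: continuous_priestley => a; exact: fo.
- by exists f => // X Y; rewrite incidence_leE /priestley_le !fE.
Qed.
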